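(* Suppose that $A$ is a weak* closed unital subalgebra of a von Neumann algebra $M$. Suppose that $\Phi:A\to D\subset B(H)$ is a unital weak* continuous completely contractive linear map into a von Neumann algebra $D$ on a Hilbert space $H$. If $A$ has the property that every state extension to $M$ of a weak* continuous state on $A$ is normal, then $\Phi$ has a normal completely positive extension $M\to B(H)$.
   Context: A unital subalgebra of $M$ is one containing $1_M$. A state on $A$ is a contractive linear functional taking the value $1$ at the identity. ''Normal'' means weak* continuous. A von Neumann algebra on $H$ contains the identity operator $I_H$, and $\Phi(1)=I_H$. *)

(* Defs.v *)
From HB Require Import structures.
From mathcomp Require Import all_boot all_order all_algebra.
From mathcomp Require Import all_classical all_reals all_analysis.
From mathcomp Require Import complex.

Set Implicit Arguments.
Unset Strict Implicit.
Unset Printing Implicit Defensive.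

Import Order.TTheory GRing.Theory Num.Theory numFieldNormedType.Exports.

Local Open Scope classical_set_scope.
Local Open Scope ring_scope.
Local Open Scope complex_scope.

(* The inner product is linear in its first argument and conjugate-linear in
   its second one (this is the convention of sesquilinear.v). *)
HB.mixin Record isHilbert (R : realType) H & CompleteNormedModule R[i] H := {
  inner : {dot H for (@Num.conj R[i])} ;
  inner_norm : forall x : H, inner x x = `|x| ^+ 2
}.

#[short(type="hilbertType")]
HB.structure Definition Hilbert (R : realType) :=
  {H of isHilbert R H & CompleteNormedModule R[i] H}.

Section BoundedOperators.
Context {R : realType} (H : hilbertType R).

Definition bounded_linear : {pred H -> H} :=
  fun T => `[< linear T /\ continuous T >].

Record bop := Bop { bop_fun :> H -> H ; _ : bop_fun \in bounded_linear }.

HB.instance Definition _ := [isSub for bop_fun].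
HB.instance Definition _ := [Choice of bop by <:].

Fact bounded_linear_submod : submod_closed bounded_linear.
Proof.
split; first by apply/asboolP; split; [move=> a x y; rewrite scaler0 addr0|
  exact: cst_continuous].
move=> a S T /asboolP[lS cS] /asboolP[lT cT]; apply/asboolP; split.
- move=> b x y; rewrite !fctE lS lT !scalerDr !scalerA (mulrC a b).
  by rewrite -!addrA; congr (_ + _); rewrite addrCA.
- by move=> x; apply: cvgD; [apply: cvgZl_tmp; exact: cS|exact: cT].
Qed.

HB.instance Definition _ :=
  GRing.isSubmodClosed.Build _ _ bounded_linear bounded_linear_submod.
HB.instance Definition _ := [SubChoice_isSubLmodule of bop by <:].

Fact bop1_subproof : (@idfun H : H -> H) \in bounded_linear.
Proof. by apply/asboolP; split => // x; exact: cvg_id. Qed.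

Definition bop1 : bop := Bop bop1_subproof.

Fact bopM_subproof (S T : bop) : (S \o T : H -> H) \in bounded_linear.
Proof.
case: S T => [S /asboolP[lS cS]] [T /asboolP[lT cT]] /=.
apply/asboolP; split; first by move=> a x y /=; rewrite lT lS.
by move=> x; apply: continuous_comp; [exact: cT|exact: cS].
Qed.

Definition bopM (S T : bop) : bop := Bop (bopM_subproof S T).

Definition adjoint (S T : bop) : Prop :=
  forall x y : H, inner (S x) y = inner x (T y).

(* A norm in a normedModType over R[i] is R[i]-valued (with zero imaginary
   part); [rnorm] is the same norm as an element of R. *)
Definition rnorm (x : H) : R := complex.Re `|x|.

Definition opnorm (T : bop) : R :=
  sup [set rnorm (T x) | x in [set x : H | rnorm x <= 1]].

(* The Hilbert space norm of the n-fold direct sum of H. *)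
Definition tuple_norm n (x : 'I_n -> H) : R :=
  Num.sqrt (\sum_i rnorm (x i) ^+ 2).

(* M_n(B(H)) acts on the n-fold direct sum of H. *)
Definition mxop n (T : 'M[bop]_n) (x : 'I_n -> H) : 'I_n -> H :=
  fun i => \sum_j T i j (x j).

Definition mxopnorm n (T : 'M[bop]_n) : R :=
  sup [set tuple_norm (mxop T x) | x in [set x | tuple_norm x <= 1]].

Definition mxpositive n (T : 'M[bop]_n) : Prop :=
  forall x : 'I_n -> H, 0 <= \sum_i inner (mxop T x i) (x i).

Definition square_summable (x : nat -> H) : Prop :=
  cvgn (series (fun k => rnorm (x k) ^+ 2 : R)).

Record l2pair := L2pair {
  l2fst : nat -> H ; l2snd : nat -> H ;
  _ : square_summable l2fst ; _ : square_summable l2snd }.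

HB.instance Definition _ := gen_eqMixin l2pair.
HB.instance Definition _ := gen_choiceMixin l2pair.

(* These are the functionals in the predual of B(H), i.e. T |-> tr (T S) with
   S of trace class. *)
Definition trace_functional (p : l2pair) (T : bop) : (R[i])^o :=
  limn (series (fun k => inner (T (l2fst p k)) (l2snd p k) : (R[i])^o)).

(* B(H) with its weak* topology: the initial topology of the functionals in
   the predual. On a von Neumann algebra on H, and on its weak* closed
   subspaces, the weak* topology is the subspace topology. *)
Definition weakstar : Type := initial_topology
  (fun (T : bop) => (fun p => trace_functional p T)
     : prod_topology (fun _ : l2pair => (R[i])^o)).
HB.instance Definition _ := Topological.on weakstar.

Definition weakstar_closed (A : set bop) : Prop := closed (A : set weakstar).

Definition unital_subalgebra (A : set bop) : Prop :=
  [/\ A bop1,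
      forall (c : R[i]) S T, A S -> A T -> A (c *: S + T) &
      forall S T, A S -> A T -> A (bopM S T)].

Definition von_neumann_algebra (M : set bop) : Prop :=
  [/\ unital_subalgebra M,
      forall S, M S -> exists2 T, M T & adjoint S T &
      weakstar_closed M].

(* In what follows a map on a subset A of B(H) is represented by a function
   on B(H), whose values outside A are irrelevant. *)
Definition linear_on (A : set bop) (V : lmodType R[i]) (f : bop -> V) : Prop :=
  forall (c : R[i]) S T, A S -> A T -> f (c *: S + T) = c *: f S + f T.

Definition state (A : set bop) (phi : bop -> (R[i])^o) : Prop :=
  [/\ linear_on A phi,
      forall T, A T -> `|phi T| <= (opnorm T)%:C &
      phi bop1 = 1].

Definition normal_functional (A : set bop) (phi : bop -> (R[i])^o) : Prop :=
  {within (A : set weakstar), continuous (phi : weakstar -> (R[i])^o)}.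

End BoundedOperators.

Section OperatorMaps.
Context {R : realType} {K H : hilbertType R}.
Implicit Types (A : set (bop K)) (Phi : bop K -> bop H).

Definition normal_map A Phi : Prop :=
  {within (A : set (weakstar K)), continuous (Phi : weakstar K -> weakstar H)}.

Definition completely_contractive A Phi : Prop :=
  forall n (T : 'M[bop K]_n), (forall i j, A (T i j)) ->
    mxopnorm (map_mx Phi T) <= mxopnorm T.

Definition completely_positive A Phi : Prop :=
  forall n (T : 'M[bop K]_n), (forall i j, A (T i j)) ->
    mxpositive T -> mxpositive (map_mx Phi T).

End OperatorMaps.

Arguments bop1 {R H}.

(* Main.v *)
(* The functional S |-> Re <Phi(S) x, y> on A is encoded by the real-valued
   functions X |-> Re <S X x, X y> on the set of all linear maps X : H -> K.
   Such a function does not change when S is replaced by S^* and x, y are swapped,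
   so the operator system A + A^* needs no separate treatment. A combination of
   these functions which is pointwise nonnegative is an accretive matrix over A,
   and unital complete contractions preserve accretivity; hence
     sum_k Re <S_k X x_k, X y_k>  |->  sum_k Re <Phi(S_k) x_k, y_k>
   is a well-defined positive functional. Krein's theorem extends it to all
   operators S in B(K), and the Riesz representation theorem turns the extension
   into a completely positive map Psi on B(K) extending Phi.
   For normality let sum_k |x_k|^2 = 1. Then T |-> sum_k <Psi(T) x_k, x_k> is a
   state of M extending the normal state T |-> sum_k <Phi(T) x_k, x_k> of A, so it
   is normal by assumption. By polarization and rescaling Psi composed with any
   functional of the predual is normal, which is the continuity of Psi. *)
From HB Require Import structures.
Require Import Defs.
From mathcomp Require Import all_boot all_order all_algebra.
From mathcomp Require Import all_classical all_reals all_analysis.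
From mathcomp Require Import complex.
From mathcomp Require Import ring lra.

Set Implicit Arguments.
Unset Strict Implicit.
Unset Printing Implicit Defensive.

Import Order.TTheory GRing.Theory Num.Theory numFieldNormedType.Exports.

Local Open Scope classical_set_scope.
Local Open Scope ring_scope.
Local Open Scope complex_scope.

(** * Hilbert space operators *)

Section RealInnerProduct.
Context {R : realType} {H : hilbertType R}.
Implicit Types x y z : H.

Definition rinner x y : R := complex.Re (inner x y).

Lemma ReD (a b : R[i]) : complex.Re (a + b) = complex.Re a + complex.Re b.
Proof. by case: a b => [? ?] [? ?]. Qed.

Lemma ImD (a b : R[i]) : complex.Im (a + b) = complex.Im a + complex.Im b.
Proof. by case: a b => [? ?] [? ?]. Qed.

Lemma ReN (a : R[i]) : complex.Re (- a) = - complex.Re a.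
Proof. by case: a. Qed.

Lemma ReZ (t : R) (a : R[i]) : complex.Re (t%:C * a) = t * complex.Re a.
Proof. by case: a => a b /=; rewrite mul0r subr0. Qed.

Lemma ReJ (a : R[i]) : complex.Re a^* = complex.Re a.
Proof. by case: a. Qed.

Lemma rinnerDl x y z : rinner (x + y) z = rinner x z + rinner y z.
Proof. by rewrite /rinner linearDl ReD. Qed.

Lemma innerC x y : inner x y = (inner y x)^*.
Proof. by rewrite hermC expr0 mul1r. Qed.

Lemma rinnerC x y : rinner x y = rinner y x.
Proof. by rewrite /rinner innerC ReJ. Qed.

Lemma rinnerDr x y z : rinner z (x + y) = rinner z x + rinner z y.
Proof. by rewrite rinnerC rinnerDl !(rinnerC z). Qed.

Lemma innerDl x y z : inner (x + y) z = inner x z + inner y z.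
Proof. exact: linearDl. Qed.

Lemma innerZl c x y : inner (c *: x) y = c * inner x y.
Proof. by rewrite linearZl_LR. Qed.

Lemma innerZr c x y : inner x (c *: y) = c^* * inner x y.
Proof. by rewrite innerC innerZl rmorphM [in RHS]innerC. Qed.

Lemma rinnerZ c x y : rinner (c *: x) y = rinner x (c^* *: y).
Proof. by rewrite /rinner innerZl innerZr conjCK. Qed.

Lemma rinnerZl (t : R) x y : rinner (t%:C *: x) y = t * rinner x y.
Proof. by rewrite /rinner innerZl ReZ. Qed.

Lemma rinnerZr (t : R) x y : rinner x (t%:C *: y) = t * rinner x y.
Proof. by rewrite rinnerC rinnerZl rinnerC. Qed.

Lemma rinnerNl x y : rinner (- x) y = - rinner x y.
Proof. by rewrite /rinner linearNl ReN. Qed.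

Lemma rinnerNr x y : rinner x (- y) = - rinner x y.
Proof. by rewrite rinnerC rinnerNl rinnerC. Qed.

Lemma rinner0l y : rinner 0 y = 0.
Proof. by rewrite /rinner linear0l. Qed.

Lemma rinner0r y : rinner y 0 = 0.
Proof. by rewrite rinnerC rinner0l. Qed.

Lemma rinner_suml n (x : 'I_n -> H) y :
  rinner (\sum_i x i) y = \sum_i rinner (x i) y.
Proof.
by elim/big_ind2: _ => [|u a v b <- <-|//]; rewrite ?rinner0l ?rinnerDl.
Qed.

Lemma rinner_sumr n (x : 'I_n -> H) y :
  rinner y (\sum_i x i) = \sum_i rinner y (x i).
Proof. by rewrite rinnerC rinner_suml; apply: eq_bigr => i _; rewrite rinnerC. Qed.

(** The second slot is conjugate-linear, so Re <x, i y> = Re (-i <x, y>) is the imaginary part of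
    <x, y>. Complex-valued statements are later reduced to [rinner] in this way. *)
Lemma innerE x y : inner x y = rinner x y +i* rinner x ('i *: y).
Proof.
rewrite /rinner innerZr; case: (inner x y) => a b /=.
by rewrite mul0r sub0r mulN1r opprK.
Qed.

Lemma Im_inner x y : complex.Im (inner x y) = rinner x ('i *: y).
Proof. by rewrite innerE. Qed.

Lemma rnormE x : `|x| = (rnorm x)%:C.
Proof. by rewrite /rnorm RRe_real // normr_real. Qed.

Lemma rnorm_ge0 x : 0 <= rnorm x.
Proof. by have := normr_ge0 x; rewrite rnormE ler0c. Qed.

Lemma rnormZ c x : rnorm (c *: x) = complex.Re `|c| * rnorm x.
Proof. by rewrite {1}/rnorm normrZ mulrC (rnormE x) ReZ mulrC. Qed.

Lemma rnorm_sqr x : rnorm x ^+ 2 = rinner x x.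
Proof. by rewrite /rinner inner_norm rnormE -rmorphXn. Qed.

Lemma rnorm0 : rnorm (0 : H) = 0.
Proof. by rewrite /rnorm normr0. Qed.

Lemma ler_rnormD x y : rnorm (x + y) <= rnorm x + rnorm y.
Proof. by rewrite -lecR rmorphD /= -!rnormE ler_normD. Qed.

Lemma rnorm_eq0 x : rnorm x = 0 -> x = 0.
Proof. by move=> x0; apply/eqP; rewrite -normr_eq0 rnormE x0. Qed.

Lemma rinner_ge0 x : 0 <= rinner x x.
Proof. by rewrite -rnorm_sqr sqr_ge0. Qed.

Lemma rnormN x : rnorm (- x) = rnorm x.
Proof. by rewrite /rnorm normrN. Qed.

Lemma rinner_le x y : rinner x y <= (rinner x x + rinner y y) / 2.
Proof.
have := rinner_ge0 (x - y).
rewrite rinnerDl !rinnerDr !rinnerNl !rinnerNr (rinnerC y x); lra.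
Qed.

Lemma rinner_inj x y : (forall z, rinner x z = rinner y z) -> x = y.
Proof.
move=> xy; apply/eqP; rewrite -subr_eq0; apply/eqP/rnorm_eq0/eqP.
by rewrite -sqrf_eq0 rnorm_sqr rinnerDl rinnerNl xy subrr.
Qed.

End RealInnerProduct.

(** * Continuity and boundedness of linear operators *)

Section OperatorNorm.
Context {R : realType} {H : hilbertType R}.
Implicit Types (S T : bop H) (x y : H).

Lemma bopE T c x y : T (c *: x + y) = c *: T x + T y.
Proof. by case: T => T /= /asboolP[lT _]; rewrite lT. Qed.

Lemma bop0 T : T 0 = 0.
Proof.
have := bopE T 1 0 0; rewrite !scale1r addr0.
by rewrite -[X in X = _]addr0 => /addrI.
Qed.

Lemma bopD T x y : T (x + y) = T x + T y.
Proof. by have := bopE T 1 x y; rewrite !scale1r. Qed.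

Lemma bopZ T c x : T (c *: x) = c *: T x.
Proof. by have := bopE T c x 0; rewrite bop0 !addr0. Qed.

Lemma bop_bounded T :
  exists2 C : R, 0 <= C & forall x, rnorm (T x) <= C * rnorm x.
Proof.
case: T => T /= /asboolP[lT cT].
pose mT := GRing.isLinear.Build _ _ _ _ _ lT.
pose T' : {linear H -> H} := HB.pack T mT.
have /linear_boundedP [M [Mr]] : bounded_near T' (nbhs 0).
  by apply/continuous_linear_bounded; exact: cT.
have /complex_realP[r Mr'] := Mr.
(* Every constant above [r] is admissible, and this one is also nonnegative. *)
move=> /(_ (`|r| + 1)%:C); rewrite Mr' ltcR => bT.
exists (`|r| + 1); first by have := normr_ge0 r; lra.
move=> x; rewrite -lecR rmorphM /= -!rnormE; apply: bT.
by have := ler_norm r; lra.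
Qed.

Lemma bounded_bop (f : H -> H) (C : R) : linear f ->
  (forall x, rnorm (f x) <= C * rnorm x) -> f \in @bounded_linear R H.
Proof.
move=> lf bf; apply/asboolP; split => //.
pose mf := GRing.isLinear.Build _ _ _ _ _ lf.
pose f' : {linear H -> H} := HB.pack f mf.
apply: (@bounded_linear_continuous _ _ _ f'); apply/linear_boundedP.
near=> r => x; rewrite /f' /= rnormE.
apply: (@le_trans _ _ (C%:C * `|x|)); first by rewrite rnormE -rmorphM lecR.
rewrite ler_wpM2r //; near: r; apply: nbhs_pinfty_ge.
by apply/complex_realP; exists C.
Unshelve. all: by end_near. Qed.

End OperatorNorm.

(** Rescale [x] to p x = 1. The a priori constant [C] bounds the set, so that its [sup] is a genuine
    supremum, and settles the case p x = 0. General [p] and [q] let the lemma serve both [opnorm]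
    and [mxopnorm]. *)
Lemma le_sup_unit_ball (R : realType) (V : lmodType R[i]) (p q : V -> R) (C : R) :
  (forall (t : R) x, 0 <= t -> p (t%:C *: x) = t * p x) ->
  (forall (t : R) x, 0 <= t -> q (t%:C *: x) = t * q x) ->
  (forall x, 0 <= p x) -> 0 <= C ->
  (forall x, q x <= C * p x) ->
  forall x, q x <= sup [set q x | x in [set x | p x <= 1]] * p x.
Proof.
move=> pZ qZ p0 C0 qC x.
have ub : has_sup [set q x | x in [set x | p x <= 1]].
  split; first by exists (q 0), 0 => //=; have := pZ 0 0 (lexx _);
    rewrite scaler0 mul0r => ->.
  exists C => _ [y /= y1 <-]; apply: (le_trans (qC y)).
  by rewrite -[leRHS]mulr1 ler_wpM2l.
have [px|px] := eqVneq (p x) 0.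
  by have := qC x; rewrite px !mulr0.
have pgt0 : 0 < p x by rewrite lt_neqAle eq_sym px p0.
rewrite -ler_pdivrMr // mulrC -qZ ?invr_ge0 //; apply: ub_le_sup; first by case: ub.
by exists ((p x)^-1%:C *: x) => //=; rewrite pZ ?invr_ge0 // mulVf.
Qed.

(** * Norms of operators and of operator matrices *)

Section MatrixNorm.
Context {R : realType} {H : hilbertType R}.
Implicit Types (S T : bop H).

Lemma le_opnorm T x : rnorm (T x) <= opnorm T * rnorm x.
Proof.
have [C C0 bC] := bop_bounded T.
apply: (@le_sup_unit_ball R H (@rnorm R H) (fun x => rnorm (T x)) C) => //.
- by move=> t y t0; rewrite rnormZ normc_def /= expr0n addr0 sqrtr_sqr ger0_norm.
- move=> t y t0 /=.
  by rewrite bopZ rnormZ normc_def /= expr0n addr0 sqrtr_sqr ger0_norm.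
- exact: rnorm_ge0.
Qed.

Lemma opnorm_ge0 T : 0 <= opnorm T.
Proof.
have [C C0 bC] := bop_bounded T.
apply: (@ub_le_sup _ [set rnorm (T x) | x in [set x : H | rnorm x <= 1]]).
  exists C => _ [y /= y1 <-]; apply: (le_trans (bC y)).
  by rewrite -[leRHS]mulr1 ler_wpM2l.
by exists 0; rewrite /= ?rnorm0 // bop0 rnorm0.
Qed.

Lemma tuple_norm_sqr n (x : 'I_n -> H) :
  tuple_norm x ^+ 2 = \sum_i rinner (x i) (x i).
Proof.
rewrite sqr_sqrtr; last by apply: sumr_ge0 => i _; rewrite sqr_ge0.
by apply: eq_bigr => i _; rewrite rnorm_sqr.
Qed.

Lemma tuple_norm_ge0 n (x : 'I_n -> H) : 0 <= tuple_norm x.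
Proof. exact: sqrtr_ge0. Qed.

Lemma tuple_normZ n (t : R) (x : 'I_n -> H) :
  0 <= t -> tuple_norm (t%:C *: x) = t * tuple_norm x.
Proof.
move=> t0; apply/eqP.
rewrite -(@eqrXn2 _ 2) ?mulr_ge0 ?tuple_norm_ge0 // exprMn !tuple_norm_sqr.
by rewrite mulr_sumr; apply/eqP/eq_bigr => i _; rewrite rinnerZl rinnerZr; ring.
Qed.

Lemma mxopZ n (T : 'M[bop H]_n) c (x : 'I_n -> H) : mxop T (c *: x) = c *: mxop T x.
Proof.
apply/funext => i; rewrite -[RHS]/(c *: \sum_j T i j (x j)) scaler_sumr.
by apply: eq_bigr => j _; rewrite bopZ.
Qed.

Lemma mxop_bounded n (T : 'M[bop H]_n) :
  exists2 C : R, 0 <= C & forall x, tuple_norm (mxop T x) <= C * tuple_norm x.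
Proof.
(* Row [i] satisfies |(T x)_i| <= sum_j |T_ij| |x_j| <= d_i |x|; summing squares gives the constant
   sqrt (sum_i d_i^2). *)
pose d i := \sum_j opnorm (T i j).
have d0 i : 0 <= d i by apply: sumr_ge0 => j _; exact: opnorm_ge0.
have le_tuple (x : 'I_n -> H) j : rnorm (x j) <= tuple_norm x.
  rewrite -(@ler_pXn2r _ 2) ?nnegrE ?tuple_norm_ge0 ?rnorm_ge0 //.
  rewrite tuple_norm_sqr rnorm_sqr (bigD1 j) //= lerDl.
  by apply: sumr_ge0 => i _; exact: rinner_ge0.
exists (Num.sqrt (\sum_i d i ^+ 2)) => [|x]; first exact: sqrtr_ge0.
rewrite -(@ler_pXn2r _ 2) ?nnegrE ?mulr_ge0 ?tuple_norm_ge0 ?sqrtr_ge0 //.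
rewrite exprMn (tuple_norm_sqr (mxop T x)) sqr_sqrtr; last first.
  by apply: sumr_ge0 => i _; rewrite sqr_ge0.
rewrite mulr_suml; apply: ler_sum => i _.
rewrite -rnorm_sqr -exprMn ler_pXn2r ?nnegrE ?mulr_ge0 ?tuple_norm_ge0 ?rnorm_ge0 //.
rewrite /d /mxop mulr_suml.
elim/big_ind2: _ => [|u a v b ua vb|j _]; first by rewrite rnorm0.
  by rewrite (le_trans (ler_rnormD _ _)) // lerD.
rewrite (le_trans (le_opnorm _ _)) // ler_wpM2l ?opnorm_ge0 //.
Qed.

Lemma le_mxopnorm n (T : 'M[bop H]_n) x :
  tuple_norm (mxop T x) <= mxopnorm T * tuple_norm x.
Proof.
have [C C0 bC] := mxop_bounded T.
apply: (@le_sup_unit_ball R ('I_n -> H) (@tuple_norm R H n)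
  (fun x => tuple_norm (mxop T x)) C) => //.
- by move=> t y t0; rewrite tuple_normZ.
- by move=> t y t0 /=; rewrite mxopZ tuple_normZ.
- exact: tuple_norm_ge0.
Qed.

Lemma mxopnorm_le n (T : 'M[bop H]_n) (C : R) : 0 <= C ->
  (forall x, tuple_norm (mxop T x) <= C * tuple_norm x) -> mxopnorm T <= C.
Proof.
move=> C0 bC; apply: ge_sup.
  exists (tuple_norm (mxop T 0)), 0 => //=.
  by rewrite -[X in tuple_norm X](scaler0 _ (0%:C)) tuple_normZ // mul0r.
move=> _ [y /= y1 <-]; apply: (le_trans (bC y)).
by rewrite -[leRHS]mulr1 ler_wpM2l.
Qed.

End MatrixNorm.

(** * Krein's extension theorem *)

Section PositiveExtension.
Context {R : realType} {E : lmodType R}.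
Variable C : set E.
Hypothesis CD : forall u v, C u -> C v -> C (u + v).
Hypothesis CZ : forall (t : R) u, 0 <= t -> C u -> C (t *: u).

(** A partially defined positive functional is encoded by its graph, so that extension is inclusion
    and a chain is bounded by its union. Single-valuedness follows from positivity. *)
Definition positive_graph (G : set (E * R)) :=
  [/\ G (0, 0),
      forall c u a v b, G (u, a) -> G (v, b) -> G (c *: u + v, c * a + b) &
      forall u a, G (u, a) -> C u -> 0 <= a].

(** In the order defined by [C] this reads -w <= v <= w with [w] in the domain of [G]: the
    majorization condition of Krein's theorem. *)
Definition dominated (G : set (E * R)) (v : E) :=
  exists w a, [/\ G (w, a), C (w - v) & C (w + v)].

Lemma positive_graphZ G c u a : positive_graph G -> G (u, a) -> G (c *: u, c * a).
Proof. by case=> G0 GL _ Gu; have := GL c _ _ _ _ Gu G0; rewrite !addr0. Qed.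

Lemma positive_graphD G u a v b :
  positive_graph G -> G (u, a) -> G (v, b) -> G (u + v, a + b).
Proof. by case=> G0 GL _ Gu Gv; have := GL 1 _ _ _ _ Gu Gv; rewrite scale1r mul1r. Qed.

(** Both (0, b - a) and (0, a - b) lie in the graph and 0 lies in [C], so both differences are
    nonnegative. *)
Lemma positive_graph_fun G u a b :
  C 0 -> positive_graph G -> G (u, a) -> G (u, b) -> a = b.
Proof.
move=> C0 [_ GL Gp] Ga Gb; apply/eqP; rewrite eq_le -subr_ge0 -(subr_ge0 b a).
have := Gp _ _ (GL (-1) _ _ _ _ Ga Gb); have := Gp _ _ (GL (-1) _ _ _ _ Gb Ga).
by rewrite !scaleN1r addNr !mulN1r !(addrC (- _)) => -> // ->.
Qed.

Lemma dominated_linear G c u v : positive_graph G ->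
  dominated G u -> dominated G v -> dominated G (c *: u + v).
Proof.
move=> Gg [w [a [Gw wu uw]]] [z [b [Gz zv vz]]].
have [_ GL _] := Gg.
exists (`|c| *: w + z), (`|c| * a + b); split; first exact: GL.
- rewrite opprD addrACA; apply: CD => //.
  have [c0|c0] := leP 0 c; first by rewrite ger0_norm // -scalerBr; apply: CZ.
  rewrite ltr0_norm // -[X in _ - X]opprK -scaleNr opprK -scalerDr.
  by apply: CZ => //; rewrite oppr_ge0 ltW.
- rewrite addrACA; apply: CD => //.
  have [c0|c0] := leP 0 c; first by rewrite ger0_norm // -scalerDr; apply: CZ.
  rewrite ltr0_norm // -[X in _ + X]opprK -scaleNr -scalerBr.
  by apply: CZ => //; rewrite oppr_ge0 ltW.
Qed.

(** Extension by one vector: the value at [v] has to separate the values of [G] below [v] from those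
    above [v]. Domination by [w] makes both families nonempty. *)
Lemma positive_graph_step G v :
  positive_graph G -> dominated G v ->
  exists G', [/\ positive_graph G', G `<=` G' & exists a, G' (v, a)].
Proof.
move=> Gg [w [a [Gw wv vw]]]; have [G0 GL Gp] := Gg.
(* Values at vectors below [v]: -a belongs to [L] through -w, and [a] bounds [L] through [w]. The
   new value is the supremum. *)
pose L := [set b | exists2 u, G (u, b) & C (v - u)].
have Lub b u : G (u, b) -> C (u - v) -> ubound L b.
  move=> Gu uv d [z Gz vz]; rewrite -subr_ge0.
  have := Gp _ _ (GL (-1) _ _ _ _ Gz Gu).
  rewrite scaleN1r mulN1r (addrC _ u) (addrC _ b) -(subrKA v u).
  by apply; apply: CD.
have L0 : L !=set0.
  exists (- a), (- w); last by rewrite opprK addrC.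
  by have := positive_graphZ (-1) Gg Gw; rewrite scaleN1r mulN1r.
have hsL : has_sup L by split => //; exists a; exact: Lub Gw wv.
pose s := sup L.
have sL b u : G (u, b) -> C (v - u) -> b <= s.
  by move=> Gu uv; apply: ub_le_sup; [case: hsL|exists u].
have sU b u : G (u, b) -> C (u - v) -> s <= b.
  by move=> Gu uv; apply: ge_sup => //; exact: Lub Gu uv.
(* The span of [G] and (v, s). Whether [v] already has a value makes no difference, since uniqueness
   of values comes from positivity. *)
exists [set p | exists u b c, [/\ G (u, b), p.1 = u + c *: v & p.2 = b + c * s]].
split; last 2 first.
- by move=> [u b] Gu; exists u, b, 0; rewrite scale0r mul0r !addr0.
- by exists s; exists 0, 0, 1; rewrite scale1r mul1r !add0r.
split.
- by exists 0, 0, 0; rewrite scale0r mul0r !addr0.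
- move=> c u1 a1 u2 a2 [x1 [b1 [c1 [/= Gx1 -> ->]]]] [x2 [b2 [c2 [/= Gx2 -> ->]]]].
  exists (c *: x1 + x2), (c * b1 + b2), (c * c1 + c2); split; first exact: GL.
    by rewrite scalerDr scalerDl !scalerA addrACA.
  by ring.
move=> u b [x [d [c [/= Gx -> ->]]]] Cx.
(* Dividing x + c v by |c| puts a vector of the domain above [v] if c < 0, and below [v] if c > 0;
   then [sU] or [sL] applies. *)
have [c0|c0|c0] := ltgtP c 0.
- have nc : 0 < - c by rewrite oppr_gt0.
  have := @sU ((- c)^-1 * d) ((- c)^-1 *: x) (positive_graphZ _ Gg Gx).
  have -> : (- c)^-1 *: x - v = (- c)^-1 *: (x + c *: v).
    rewrite scalerDr scalerA invrN mulNr mulVf ?scaleN1r //.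
    by rewrite lt_eqF.
  rewrite [_ * d]mulrC ler_pdivlMr // => h.
  suff : s * - c <= d by lra.
  by apply: h; apply: CZ => //; rewrite invr_ge0 ltW.
- have := @sL (- c^-1 * d) (- c^-1 *: x) (positive_graphZ _ Gg Gx).
  have -> : v - (- c^-1 *: x) = c^-1 *: (x + c *: v).
    by rewrite scaleNr opprK scalerDr scalerA mulVf ?gt_eqF // scale1r addrC.
  rewrite mulNr lerNl [_ * d]mulrC ler_pdivlMr // => h.
  suff : - s * c <= d by lra.
  by apply: h; apply: CZ => //; rewrite invr_ge0 ltW.
- by rewrite c0 mul0r addr0; apply: Gp Gx _; move: Cx; rewrite c0 scale0r addr0.
Qed.

(* Zorn's lemma is applied to the graphs of partially defined positive functionals. *)
Lemma positive_extension (G0 : set (E * R)) : C 0 -> positive_graph G0 ->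
  exists F : E -> R,
  [/\ forall u a, G0 (u, a) -> F u = a,
      forall c u v, dominated G0 u -> dominated G0 v ->
        F (c *: u + v) = c * F u + F v &
      forall u, dominated G0 u -> C u -> 0 <= F u].
Proof.
(* The union with [G0] makes [P] hold for the empty chain and keeps [G0] inside the maximal
   graph. *)
move=> C0 G0g; pose P G := positive_graph (G `|` G0).
have [|G [PG maxG]] := @Zorn_bigcup _ P.
  move=> S SP totS.
  have S2 p q : (\bigcup_(X in S) X `|` G0) p -> (\bigcup_(X in S) X `|` G0) q ->
      exists G, [/\ positive_graph G, G p, G q & G `<=` \bigcup_(X in S) X `|` G0].
    have sub X : S X -> X `|` G0 `<=` \bigcup_(X in S) X `|` G0.
      by move=> SX; apply: setSU; exact: bigcup_sup.
    move=> [[X SX Xp]|Gp] [[Y SY Yq]|Gq].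
    - have [XY|YX] := totS _ _ SX SY.
        by exists (Y `|` G0); split; [exact: SP|left; exact: XY|left|exact: sub].
      by exists (X `|` G0); split; [exact: SP|left|left; exact: YX|exact: sub].
    - by exists (X `|` G0); split; [exact: SP|left|right|exact: sub].
    - by exists (Y `|` G0); split; [exact: SP|right|left|exact: sub].
    - by exists G0; split => // p'; right.
  split; first by right; case: G0g.
  - move=> c u a v b /S2 /[apply] -[G [[_ GL _] Gu Gv]]; apply; exact: GL.
  - by move=> u a Gu; have [G [[_ _ Gp] {}Gu _ _]] := S2 _ _ Gu Gu; exact: Gp.
have {}maxG v : dominated G0 v -> exists a, (G `|` G0) (v, a).
  move=> [w [a [Gw wv vw]]].
  have [|G' [G'g sG' [b G'v]]] := positive_graph_step (v := v) PG.
    by exists w, a; split => //; right.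
  apply: contrapT => nGv; apply: (maxG G').
    split; first by move=> p Gp; apply: sG'; left.
    by move=> sG; apply: nGv; exists b; left; exact: sG.
  by rewrite /P (setUidl (subset_trans (@subsetUr _ G G0) sG')).
(* Outside the domain of the maximal graph [F] takes the default value 0, hence its linearity is
   claimed for dominated vectors only. *)
pose F v := xget 0 [set a | (G `|` G0) (v, a)].
have FE v a : (G `|` G0) (v, a) -> F v = a.
  rewrite /F => Gva; case: xgetP => [b _ /= Gvb|/(_ a)//].
  exact: positive_graph_fun C0 PG Gvb Gva.
have FG v : dominated G0 v -> (G `|` G0) (v, F v).
  by move=> /maxG [a Gva]; rewrite (FE _ _ Gva).
have [_ GL Gp] := PG.
exists F; split => [u a Gu|c u v Du Dv|u Du Cu].
- by apply: FE; right.
- by apply/FE/GL; apply: FG.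
- by apply: Gp Cu; apply: FG.
Qed.

End PositiveExtension.

(** * The Riesz representation theorem *)

Section Riesz.
Context {R : realType} {H : hilbertType R}.

Lemma ler_rinner (x y : H) : rinner x y <= rnorm x * rnorm y.
Proof.
have [x0|x0] := eqVneq (rnorm x) 0.
  by rewrite x0 (rnorm_eq0 x0) rinner0l mul0r.
have [y0|y0] := eqVneq (rnorm y) 0.
  by rewrite y0 (rnorm_eq0 y0) rinner0r mulr0.
have xgt0 : 0 < rnorm x by rewrite lt_neqAle eq_sym x0 rnorm_ge0.
have ygt0 : 0 < rnorm y by rewrite lt_neqAle eq_sym y0 rnorm_ge0.
have := rinner_le ((rnorm x)^-1%:C *: x) ((rnorm y)^-1%:C *: y).
rewrite !rinnerZl !rinnerZr -!rnorm_sqr.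
have -> : (rnorm x)^-1 * ((rnorm x)^-1 * rnorm x ^+ 2) = 1 by field.
have -> : (rnorm y)^-1 * ((rnorm y)^-1 * rnorm y ^+ 2) = 1 by field.
have -> : (1 + 1) / 2 = 1 :> R by field.
by rewrite mulrA -invfM ler_pdivrMl ?mulr_gt0 // mulr1 mulrC.
Qed.

(** If [z] represents [l] then |x|^2 - 2 l(x) = |x - z|^2 - |z|^2, so [z] is sought as the minimizer
    of [J], the limit of a minimizing sequence. Only real linearity of [l] is involved. *)
Lemma riesz_representation (l : H -> R) (C : R) :
  (forall x y : H, l (x + y) = l x + l y) ->
  (forall (t : R) (x : H), l (t%:C *: x) = t * l x) ->
  (forall x, l x <= C * rnorm x) ->
  exists z, forall x, rinner z x = l x.
Proof.
move=> lD lZ lC; pose J (x : H) : R := rinner x x - 2 * l x.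
have JC x : - C ^+ 2 <= J x.
  by have := lC x; have := sqr_ge0 (rnorm x - C); rewrite /J -rnorm_sqr; nra.
have Jinf : has_inf [set J x | x in [set: H]].
  by split; [exists (J 0), 0|exists (- C ^+ 2) => _ [x _ <-]].
pose m := inf [set J x | x in [set: H]].
have mJ x : m <= J x by apply: ge_inf; [case: Jinf|exists x].
pose d n : R := n.+1%:R^-1.
have d0 n : 0 < d n by rewrite invr_gt0.
have exz n : exists z, J z < m + d n ^+ 2.
  have [_ [z _ <-] zm] := inf_adherent (exprn_gt0 2 (d0 n)) Jinf.
  by exists z.
pose z n : H := xget 0 [set z | J z < m + d n ^+ 2].
have Jz n : J (z n) < m + d n ^+ 2.
  by rewrite /z; case: xgetP => // /(_ _) nz; have [y /nz] := exz n.
have mJZ (t : R) (x : H) : m <= t ^+ 2 * rinner x x - 2 * t * l x.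
  have := mJ (t%:C *: x).
  by rewrite /J lZ rinnerZl rinnerZr expr2 !mulrA.
(* Parallelogram identity: |x - y|^2 = 2 J(x) + 2 J(y) - 4 J((x + y) / 2). It makes the minimizing
   sequence Cauchy, with |z_p - z_q|^2 < 2 d_p^2 + 2 d_q^2. *)
have Jmid (x y : H) : rinner (x - y) (x - y) <= 2 * J x + 2 * J y - 4 * m.
  have := mJZ 2^-1 (x + y); rewrite /J lD !rinnerDl !rinnerDr !rinnerNl !rinnerNr.
  rewrite (rinnerC y x); lra.
(* Approximate Euler equation: compare J(z_n + t x) >= m > J(z_n) - d_n^2 at t = d_n and t = - d_n,
   and divide by d_n. *)
have dz n (x : H) : `|rinner (z n) x - l x| <= d n * ((rinner x x + 1) / 2).
  have h (t : R) : 0 <= 2 * t * (rinner (z n) x - l x) + t ^+ 2 * rinner x x + d n ^+ 2.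
    pose w : H := t%:C *: x; have := mJ (z n + w); have := Jz n.
    rewrite /J lD !rinnerDl !rinnerDr (rinnerC w) /w lZ !rinnerZl !rinnerZr; lra.
  have dn := d0 n; rewrite ler_norml -(ler_pM2l dn) -[X in _ && X](ler_pM2l dn).
  by have := h (d n); have := h (- d n); lra.
have cz : cvg (z @ \oo).
  apply/cauchy_cvgP/cauchy_ballP => e e0; rewrite near_map2.
  have /complex_realP[r er] := gtr0_real e0.
  move: e0; rewrite er ltcR => r0; pose s := PosNum (divr_gt0 r0 (ltr0Sn R 1)).
  have ds : \forall n \near \oo, d n < s%:num := near_infty_natSinv_lt s.
  near=> p q; rewrite -ball_normE /= rnormE ltcR.
  rewrite -(@ltr_pXn2r _ 2) ?nnegrE ?rnorm_ge0 ?ltW // rnorm_sqr.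
  have d1 : d p < r / 2 by near: p; exact: ds.
  have d2 : d q < r / 2 by near: q; exact: ds.
  have := Jmid (z p) (z q); have := Jz p; have := Jz q.
  have := d0 p; have := d0 q; nra.
exists (lim (z @ \oo)) => x.
(* The two summands weigh the errors from [dz] and from |lim z - z_n| |x|; with both d_n and |lim z
   - z_n| below e / (X + 1) the total stays below [e]. *)
pose X := (rinner x x + 1) / 2 + rnorm x.
have X0 : 0 < X + 1.
  by have := rinner_ge0 x; have := rnorm_ge0 x; rewrite /X; lra.
apply/eqP; rewrite -subr_eq0 -normr_le0; apply/ler_addgt0Pr => e e0.
rewrite add0r.
pose s := PosNum (divr_gt0 e0 X0).
have ds : \forall n \near \oo, d n < s%:num := near_infty_natSinv_lt s.
near \oo => n.
have dn : d n < e / (X + 1) by near: n.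
have zn : rnorm (lim (z @ \oo) - z n) < e / (X + 1).
  rewrite -ltcR -rnormE; near: n; apply: (cvgrPdist_lt _ _).1 => //.
  by rewrite ltcR divr_gt0.
have h1 := dz n x.
have h2 := ler_rinner (lim (z @ \oo) - z n) x.
have h3 := ler_rinner (- (lim (z @ \oo) - z n)) x.
rewrite rnormN rinnerNl rinnerDl rinnerNl in h3.
rewrite rinnerDl rinnerNl in h2.
have h4 : e / (X + 1) * (X + 1) = e by field; rewrite gt_eqF.
have h5 : d n * ((rinner x x + 1) / 2) <= e / (X + 1) * ((rinner x x + 1) / 2).
  by apply: ler_wpM2r; [have := rinner_ge0 x; lra|exact: ltW].
have h6 : rnorm (lim (z @ \oo) - z n) * rnorm x <= e / (X + 1) * rnorm x.
  by apply: ler_wpM2r; [exact: rnorm_ge0|exact: ltW].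
have h7 : 0 < e / (X + 1) by rewrite divr_gt0.
move: h1; rewrite !ler_norml => /andP[h8 h9].
move: h4; rewrite {2}/X mulrDr mulr1 mulrDr.
move: h2 h3 h5 h6 h7 h8 h9; set k := e / _; lra.
Unshelve. all: by end_near. Qed.

End Riesz.

(** * Complete contractions and accretive matrices *)

Section BopLinear.
Context {R : realType} {H : hilbertType R}.

Lemma bop_addE (S T : bop H) x : (S + T) x = S x + T x.
Proof. by []. Qed.

Lemma bop_scaleE c (T : bop H) x : (c *: T) x = c *: T x.
Proof. by []. Qed.

Lemma bop_sumE I (s : seq I) (T : I -> bop H) x :
  (\sum_(p <- s) T p) x = \sum_(p <- s) T p x.
Proof. by elim/big_ind2: _ => // u a v b <- <-. Qed.

Lemma bop_sumr I (s : seq I) (T : bop H) (x : I -> H) :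
  T (\sum_(p <- s) x p) = \sum_(p <- s) T (x p).
Proof.
by elim/big_ind2: _ => [|u a v b <- <-|//]; rewrite ?bop0 ?bopD.
Qed.

(** Moves the scalars into the operators: a form evaluated at two combinations of the x_i becomes
    the quadratic form of an operator matrix at the tuple [x]. *)
Lemma rinner_combination n (T : bop H) (a b : 'I_n -> R[i]) (x : 'I_n -> H) :
  rinner (T (\sum_j a j *: x j)) (\sum_i b i *: x i) =
  \sum_i rinner (\sum_j (((b i)^* * a j) *: T) (x j)) (x i).
Proof.
rewrite rinner_sumr; apply: eq_bigr => i _.
rewrite -[b i]conjCK -rinnerZ conjCK bop_sumr scaler_sumr.
congr rinner; apply: eq_bigr => j _.
by rewrite bopZ bop_scaleE scalerA.
Qed.

(** Gram-Schmidt: [P] reproduces the earlier vectors, and for the residue v = x - P x the functional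
    z |-> <z - P z, v> / <v, v> vanishes on them. The coordinates are linear on the whole of [H], so
    they can be used to define linear maps from [H] to [K]. *)
Lemma finite_coordinates (s : seq H) :
  exists n (g : 'I_n -> H -> R[i]) (e : 'I_n -> H),
    (forall i c x y, g i (c *: x + y) = c * g i x + g i y) /\
    {in s, forall x, x = \sum_i g i x *: e i}.
Proof.
pose lin (g : H -> R[i]) := forall c x y, g (c *: x + y) = c * g x + g y.
(* The default of [nth] is the zero functional, so linearity may be required at every index. *)
suff [l [ll ls]] : exists l : seq ((H -> R[i]) * H),
    (forall i, lin (nth (fun=> 0, 0) l i).1) /\
    {in s, forall x, x = \sum_(p <- l) p.1 x *: p.2}.
  exists (size l), (fun i => (nth (fun=> 0, 0) l i).1),
    (fun i => (nth (fun=> 0, 0) l i).2); split => [i|x xs]; first exact: ll.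
  by rewrite {1}(ls x xs) (big_nth (fun=> 0, 0)) big_mkord.
elim: s => [|x s [l [ll ls]]].
  by exists [::]; split => // i c x y /=; rewrite nth_nil mulr0 addr0.
pose P (z : H) : H := \sum_(p <- l) p.1 z *: p.2.
have PL c y z : P (c *: y + z) = c *: P y + P z.
  rewrite /P scaler_sumr -big_split !(big_nth (fun=> 0, 0)) /=.
  by apply: eq_bigr => i _; rewrite ll scalerDl scalerA.
pose w (z : H) : H := z - P z.
have wL c (y z : H) : w (c *: y + z) = c *: w y + w z.
  by rewrite /w PL opprD addrACA -scalerBr.
pose v := w x.
have [v0|v0] := eqVneq v 0.
  exists l; split => // y; rewrite inE => /predU1P[->|/ls//].
  by apply/eqP; rewrite -subr_eq0 -/(P x) -/(w x) -/v v0.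
have vv : inner v v != 0 by rewrite inner_norm expf_neq0 // normr_eq0.
exists ((fun z => inner (w z) v / inner v v, v) :: l); split.
  case=> [|i]; last exact: ll.
  by move=> c y z /=; rewrite wL innerDl innerZl mulrDl mulrA.
move=> y; rewrite big_cons /= -/(P y) inE => /predU1P[->|/ls yE].
  by rewrite divff // scale1r subrK.
by rewrite /w {2}yE -/(P y) subrr linear0l mul0r scale0r add0r.
Qed.

End BopLinear.

Section CompletelyContractive.
Context {R : realType} {K H : hilbertType R}.
Variables (A : set (bop K)) (Phi : bop K -> bop H).
Hypothesis Aalg : unital_subalgebra A.
Hypothesis Phi_linear : linear_on A Phi.
Hypothesis Phi1 : Phi bop1 = bop1.
Hypothesis Phi_cc : completely_contractive A Phi.

Lemma subalgebra1 : A bop1.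
Proof. by case: Aalg. Qed.

Lemma subalgebra0 : A 0.
Proof.
by case: Aalg => A1 AL _; have := AL (-1) _ _ A1 A1; rewrite scaleN1r addNr.
Qed.

Lemma subalgebraZ c T : A T -> A (c *: T).
Proof.
by case: Aalg => _ AL _ AT; have := AL c _ _ AT subalgebra0; rewrite addr0.
Qed.

Lemma linear_on0 : Phi 0 = 0.
Proof.
have := Phi_linear 1 subalgebra0 subalgebra0; rewrite !scale1r addr0.
by rewrite -[X in X = _]addr0 => /addrI.
Qed.

Lemma linear_onZ c T : A T -> Phi (c *: T) = c *: Phi T.
Proof. by move=> AT; have := Phi_linear c AT subalgebra0; rewrite linear_on0 !addr0. Qed.

Lemma linear_on_sum (I : eqType) (s : seq I) (c : I -> R[i]) (T : I -> bop K) :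
  {in s, forall p, A (T p)} ->
  A (\sum_(p <- s) c p *: T p) /\
  Phi (\sum_(p <- s) c p *: T p) = \sum_(p <- s) c p *: Phi (T p).
Proof.
elim: s => [|p s IH] AT.
  by rewrite !big_nil; split; [exact: subalgebra0|exact: linear_on0].
have [|As Ps] := IH; first by move=> q qs; apply: AT; rewrite inE qs orbT.
have Ap : A (T p) by apply: AT; rewrite inE eqxx.
rewrite !big_cons Phi_linear // Ps; split => //.
by case: Aalg => _ AL _; apply: AL.
Qed.

(* A matrix T is accretive if and only if |1 - t T|^2 <= 1 + O(t^2) as t tends to
   0 from above, and unital complete contractions preserve these inequalities. *)
Lemma completely_contractive_accretive n (T : 'M[bop K]_n) :
  (forall i j, A (T i j)) ->
  (forall x, 0 <= \sum_i rinner (mxop T x i) (x i)) ->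
  forall e, 0 <= \sum_i rinner (mxop (map_mx Phi T) e i) (e i).
Proof.
move=> AT accT e.
have [C C0 bC] := mxop_bounded T.
pose B (t : R) : 'M[bop K]_n :=
  \matrix_(i, j) ((- t%:C) *: T i j + (i == j)%:R *: bop1).
have AB t i j : A (B t i j).
  case: Aalg => _ AL _; rewrite mxE; apply: AL => //.
  by apply: subalgebraZ; exact: subalgebra1.
have sumE (L : hilbertType R) (S : 'M[bop L]_n) (t : R) x i :
    \sum_j ((- t%:C) *: S i j + (i == j)%:R *: bop1) (x j) =
    x i - t%:C *: mxop S x i.
  rewrite /mxop scaler_sumr -sumrN [RHS]addrC.
  rewrite (eq_bigr (fun j => - (t%:C *: S i j (x j)) + (i == j)%:R *: x j)).
    rewrite big_split /=; congr (_ + _).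
    rewrite (bigD1 i) //= eqxx scale1r big1 ?addr0 // => j.
    by rewrite eq_sym => /negbTE ->; rewrite scale0r.
  by move=> j _; rewrite bop_addE !bop_scaleE scaleNr.
have normE (L : hilbertType R) (S : 'M[bop L]_n) (t : R) x :
    tuple_norm (fun i => x i - t%:C *: mxop S x i) ^+ 2 =
    tuple_norm x ^+ 2 - 2 * t * \sum_i rinner (mxop S x i) (x i)
      + t ^+ 2 * tuple_norm (mxop S x) ^+ 2.
  rewrite !tuple_norm_sqr !mulr_sumr -sumrN -!big_split /=.
  apply: eq_bigr => i _.
  rewrite rinnerDl !rinnerDr !rinnerNl !rinnerNr !rinnerZl !rinnerZr.
  by rewrite (rinnerC (x i) (mxop S x i)); ring.
have BE t x : mxop (B t) x = fun i => x i - t%:C *: mxop T x i.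
  by apply/funext => i; rewrite -sumE /mxop; apply: eq_bigr => j _; rewrite mxE.
have PhiBE t : mxop (map_mx Phi (B t)) e =
    fun i => e i - t%:C *: mxop (map_mx Phi T) e i.
  apply/funext => i; rewrite -sumE /mxop; apply: eq_bigr => j _.
  have A1 := subalgebra1.
  by rewrite !mxE Phi_linear ?linear_onZ ?Phi1 //; apply: subalgebraZ.
have Bbound (t : R) : 0 <= t -> mxopnorm (B t) <= Num.sqrt (1 + t ^+ 2 * C ^+ 2).
  move=> t0; apply: mxopnorm_le => [|x]; first exact: sqrtr_ge0.
  rewrite -(@ler_pXn2r _ 2) ?nnegrE ?mulr_ge0 ?tuple_norm_ge0 ?sqrtr_ge0 //.
  have q0 : 0 <= 1 + t ^+ 2 * C ^+ 2 by rewrite addr_ge0 // mulr_ge0 // sqr_ge0.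
  rewrite exprMn BE normE (sqr_sqrtr q0).
  have h1 := accT x.
  have h2 : tuple_norm (mxop T x) ^+ 2 <= (C * tuple_norm x) ^+ 2.
    by rewrite ler_pXn2r ?nnegrE ?mulr_ge0 ?tuple_norm_ge0.
  have h3 := mulr_ge0 t0 h1.
  have h4 : t ^+ 2 * tuple_norm (mxop T x) ^+ 2 <= t ^+ 2 * (C * tuple_norm x) ^+ 2.
    by rewrite ler_wpM2l ?sqr_ge0.
  move: h3 h4; rewrite exprMn; lra.
(* The bound on 1 - t T passes to 1 - t Phi(T). Expanding it at [e], dropping the square t^2 |Phi(T)
   e|^2 and dividing by 2 t leaves an error of order [t]. *)
have key (t : R) : 0 < t -> - (t * (C ^+ 2 * tuple_norm e ^+ 2) / 2) <=
    \sum_i rinner (mxop (map_mx Phi T) e i) (e i).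
  move=> t0.
  have : tuple_norm (mxop (map_mx Phi (B t)) e) ^+ 2 <=
      (1 + t ^+ 2 * C ^+ 2) * tuple_norm e ^+ 2.
    have q0 : 0 <= 1 + t ^+ 2 * C ^+ 2 by rewrite addr_ge0 // mulr_ge0 // sqr_ge0.
    rewrite -[X in _ <= X * _](sqr_sqrtr q0) -exprMn.
    rewrite ler_pXn2r ?nnegrE ?mulr_ge0 ?tuple_norm_ge0 ?sqrtr_ge0 //.
    apply: (le_trans (le_mxopnorm _ _)); rewrite ler_wpM2r ?tuple_norm_ge0 //.
    by apply: (le_trans (Phi_cc (AB t))); apply: Bbound; exact: ltW.
  rewrite PhiBE normE => h.
  have h2 : 0 <= t ^+ 2 * tuple_norm (mxop (map_mx Phi T) e) ^+ 2.
    by rewrite mulr_ge0 ?sqr_ge0.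
  rewrite -(ler_pM2l t0); move: h h2; lra.
apply/ler_addgt0Pr => d d0.
(* With t = d / (q + 1) the error t q / 2 is below [d]; the added 1 keeps the denominator
   positive. *)
pose q := C ^+ 2 * tuple_norm e ^+ 2.
have q0 : 0 <= q by rewrite mulr_ge0 ?sqr_ge0.
have qn : q + 1 != 0 by rewrite gt_eqF // ltr_wpDl.
have := key (d / (q + 1)); rewrite -/q divr_gt0 ?ltr_wpDl // => /(_ isT).
have -> : d / (q + 1) * q = d - d / (q + 1) by field.
have : 0 < d / (q + 1) by rewrite divr_gt0 ?ltr_wpDl.
lra.
Qed.

Definition linear_form (T : bop K) (x y : H) : {linear H -> K} -> R^o :=
  fun X => rinner (T (X x)) (X y).

(** A relation, because one function may be a sum of forms in several ways; that the value does not
    depend on the choice follows from positivity. *)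
Definition form_graph : set (({linear H -> K} -> R^o) * R) :=
  [set p | exists2 s : seq (bop K * H * H), {in s, forall q, A q.1.1} &
    p.1 = \sum_(q <- s) linear_form q.1.1 q.1.2 q.2 /\
    p.2 = \sum_(q <- s) rinner (Phi q.1.1 q.1.2) q.2].

Lemma form_graph_positive :
  @positive_graph R ({linear H -> K} -> R^o) [set v | forall X, 0 <= v X] form_graph.
Proof.
split.
- by exists [::] => //; rewrite !big_nil.
- move=> c u a v b [s As [/= -> ->]] [s' As' [/= -> ->]].
  exists ([seq (q.1.1, c%:C *: q.1.2, q.2) | q <- s] ++ s').
    by move=> q; rewrite mem_cat => /orP[/mapP[q' q's ->]|]; [exact: (As q')|exact: As'].
  rewrite /= !big_cat !big_map /=; split; last first.
    rewrite mulr_sumr; congr (_ + _); apply: eq_bigr => q _.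
    by rewrite bopZ rinnerZl.
  rewrite scaler_sumr; congr (_ + _); apply: eq_bigr => q _.
  by apply/funext => X; rewrite /linear_form linearZ bopZ rinnerZl.
- move=> u a [s As [/= -> ->]] spos.
  (* In coordinates with respect to [e] for all vectors that occur, the combination is the quadratic
     form of the matrix [T] over [A], and its value is the quadratic form of Phi(T) at [e]. *)
  have [n [g [e [gL ge]]]] := finite_coordinates
    ([seq q.1.2 | q <- s] ++ [seq q.2 | q <- s]).
  pose c i j (q : bop K * H * H) := (g i q.2)^* * g j q.1.2.
  pose T : 'M[bop K]_n := \matrix_(i, j) \sum_(q <- s) c i j q *: q.1.1.
  (* Used twice: with F = Phi at the tuple [e], and with the identity at an arbitrary tuple of
     [K]. *)
  have sumT (L : hilbertType R) (F : bop K -> bop L) (x : 'I_n -> L) :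
      \sum_i rinner (\sum_j (\sum_(q <- s) c i j q *: F q.1.1) (x j)) (x i) =
      \sum_(q <- s) rinner (F q.1.1 (\sum_j g j q.1.2 *: x j)) (\sum_i g i q.2 *: x i).
    under [RHS]eq_bigr do rewrite rinner_combination.
    rewrite exchange_big /=; apply: eq_bigr => i _.
    rewrite [RHS](_ : _ = rinner (\sum_(q <- s) \sum_j (c i j q *: F q.1.1) (x j)) (x i)).
      rewrite exchange_big /=; congr rinner; apply: eq_bigr => j _.
      by rewrite bop_sumE.
    by elim/big_ind2: _ => [|w d z f -> ->|//]; rewrite ?rinner0l ?rinnerDl.
  have AT i j : A (T i j).
    by rewrite mxE; apply: (linear_on_sum (c i j) (T := fun q => q.1.1) _).1.
  have -> : \sum_(q <- s) rinner (Phi q.1.1 q.1.2) q.2 =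
      \sum_i rinner (mxop (map_mx Phi T) e i) (e i).
    rewrite big_seq (eq_bigr (fun q => rinner (Phi q.1.1 (\sum_j g j q.1.2 *: e j))
      (\sum_i g i q.2 *: e i))) -?big_seq; last first.
      move=> q qs; rewrite -(ge q.1.2) -?(ge q.2) // mem_cat; apply/orP.
        by right; apply/mapP; exists q.
      by left; apply/mapP; exists q.
    rewrite -sumT; apply: eq_bigr => i _; congr rinner; apply: eq_bigr => j _.
    by rewrite !mxE (linear_on_sum (c i j) (T := fun q => q.1.1) _).2.
  apply: completely_contractive_accretive => // x.
  (* Every tuple [x] of [K] comes from a linear map [X], so nonnegativity of the combination at all
     [X] is accretivity of [T]. *)
  have [X XE] : exists X : {linear H -> K}, forall z, X z = \sum_i g i z *: x i.
    pose f z : K := \sum_i g i z *: x i.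
    have fL : linear f.
      move=> b y z; rewrite /f scaler_sumr -big_split /=.
      by apply: eq_bigr => i _; rewrite gL scalerDl scalerA.
    pose mf := GRing.isLinear.Build _ _ _ _ _ fL.
    by exists (HB.pack f mf : {linear H -> K}).
  have := spos X; rewrite fct_sumE /linear_form.
  under eq_bigr do rewrite !XE.
  rewrite -(sumT _ id) => /le_trans; apply; rewrite le_eqVlt; apply/orP; left.
  apply/eqP/eq_bigr => i _; congr rinner; apply: eq_bigr => j _.
  by rewrite mxE.
Qed.

End CompletelyContractive.

(** * The completely positive extension *)

Section Arveson.
Context {R : realType} {K H : hilbertType R}.

Lemma Re_sum I (s : seq I) (F : I -> R[i]) :
  complex.Re (\sum_(i <- s) F i) = \sum_(i <- s) complex.Re (F i).
Proof. by elim/big_ind2: _ => [|u a v b <- <-|//]; rewrite ?ReD. Qed.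

Lemma Im_sum I (s : seq I) (F : I -> R[i]) :
  complex.Im (\sum_(i <- s) F i) = \sum_(i <- s) complex.Im (F i).
Proof. by elim/big_ind2: _ => [|u a v b <- <-|//]; rewrite ?ImD. Qed.

Lemma linear_formDl (T : bop K) (x y z : H) :
  linear_form T (x + y) z = linear_form T x z + linear_form T y z.
Proof. by apply/funext => X; rewrite /linear_form linearD bopD rinnerDl. Qed.

Lemma linear_formDr (T : bop K) (x y z : H) :
  linear_form T x (y + z) = linear_form T x y + linear_form T x z.
Proof. by apply/funext => X; rewrite /linear_form linearD rinnerDr. Qed.

Lemma linear_formZr (T : bop K) (t : R) (x y : H) :
  linear_form T x (t%:C *: y) = t *: linear_form T x y.
Proof. by apply/funext => X; rewrite /linear_form linearZ rinnerZr. Qed.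

Lemma linear_formZ (T : bop K) (c : R[i]) (x y : H) :
  linear_form T (c *: x) y = linear_form T x (c^* *: y).
Proof. by apply/funext => X; rewrite /linear_form !linearZZ bopZ rinnerZ. Qed.

Lemma linear_form_op (c : R[i]) (S T : bop K) (x y : H) :
  linear_form (c *: S + T) x y = linear_form S x (c^* *: y) + linear_form T x y.
Proof.
apply/funext => X.
rewrite -[RHS]/(linear_form S x (c^* *: y) X + linear_form T x y X).
by rewrite /linear_form bop_addE bop_scaleE rinnerDl rinnerZ linearZZ.
Qed.

(** Cauchy-Schwarz and 2ab <= a^2 + b^2. The right-hand side is a combination of forms of the
    identity, which belongs to [A]; hence the form of any operator is dominated. *)
Lemma linear_form_le (T : bop K) (k : R) (x y : H) X :
  0 <= k -> (forall z, rnorm (T z) <= k * rnorm z) ->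
  linear_form T x y X <= k / 2 * (rinner (X x) (X x) + rinner (X y) (X y)).
Proof.
move=> k0 Tk; apply: (le_trans (ler_rinner _ _)); rewrite -!rnorm_sqr.
have h : rnorm (T (X x)) * rnorm (X y) <= k * rnorm (X x) * rnorm (X y).
  by rewrite ler_wpM2r ?rnorm_ge0.
apply: (le_trans h).
have := mulr_ge0 k0 (sqr_ge0 (rnorm (X x) - rnorm (X y))).
nra.
Qed.

Variables (A : set (bop K)) (Phi : bop K -> bop H).
Hypothesis Aalg : unital_subalgebra A.
Hypothesis Phi_linear : linear_on A Phi.
Hypothesis Phi1 : Phi bop1 = bop1.
Hypothesis Phi_cc : completely_contractive A Phi.

Local Notation E := ({linear H -> K} -> R^o).
Let C : set E := [set v | forall X, 0 <= v X].
Let G := form_graph A Phi.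
Let Gpos : positive_graph C G := form_graph_positive Aalg Phi_linear Phi1 Phi_cc.

Let bound (k : R) (x y : H) : E :=
  (k / 2) *: (linear_form bop1 x x + linear_form bop1 y y).

Let form_graph1 T (x y : H) : A T -> G (linear_form T x y, rinner (Phi T x) y).
Proof.
move=> AT; exists [:: (T, x, y)]; first by move=> q; rewrite inE => /eqP ->.
by rewrite !big_seq1.
Qed.

Let form_graph_bound k x y : G (bound k x y, k / 2 * (rinner x x + rinner y y)).
Proof.
have A1 := subalgebra1 Aalg.
have := positive_graphD Gpos (form_graph1 x x A1) (form_graph1 y y A1).
by move=> /(positive_graphZ (k / 2) Gpos); rewrite Phi1.
Qed.

Let C_bound (T : bop K) (k : R) (x y : H) :
  0 <= k -> (forall z, rnorm (T z) <= k * rnorm z) ->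
  C (bound k x y - linear_form T x y).
Proof. by move=> k0 Tk X; rewrite subr_ge0; exact: linear_form_le. Qed.

Let form_dominated (T : bop K) (x y : H) : dominated C G (linear_form T x y).
Proof.
have T0 := opnorm_ge0 T; have Tk := le_opnorm T.
exists (bound (opnorm T) x y), (opnorm T / 2 * (rinner x x + rinner y y)).
split; [exact: form_graph_bound|exact: C_bound|].
have NTk z : rnorm ((- T) z) <= opnorm T * rnorm z.
  by rewrite [(- T) z](_ : _ = - T z) // rnormN.
move=> X; have := C_bound x y T0 NTk X.
rewrite -[X in 0 <= X]/(bound (opnorm T) x y X - rinner (- T (X x)) (X y)).
by rewrite rinnerNl opprK.
Qed.

(** [Psi] is read off from the extended functional by Riesz. The last clause later yields
    contractivity of the states built from [Psi]. *)
Lemma completely_positive_extension : exists Psi : bop K -> bop H,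
  [/\ forall (c : R[i]) S T, Psi (c *: S + T) = c *: Psi S + Psi T,
      forall T, A T -> Psi T = Phi T,
      completely_positive setT Psi &
      forall (T : bop K) (k : R) (x : H), 0 <= k ->
        (forall z, rnorm (T z) <= k * rnorm z) ->
        rinner (Psi T x) x <= k * rinner x x].
Proof.
have C0 : C 0 by [].
have CD u v : C u -> C v -> C (u + v) by move=> Cu Cv X; apply: addr_ge0.
have CZ (t : R) u : 0 <= t -> C u -> C (t *: u).
  by move=> t0 Cu X; apply: mulr_ge0.
have [F [FG FL Fpos]] := positive_extension CD CZ C0 Gpos.
have D0 : dominated C G 0.
  by exists 0, 0; rewrite subr0 addr0; split => //; case: Gpos.
have F0 : F 0 = 0 by apply: FG; case: Gpos.
have FD u v : dominated C G u -> dominated C G v -> F (u + v) = F u + F v.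
  by move=> Du Dv; have := FL 1 u v Du Dv; rewrite scale1r mul1r.
have FZ c u : dominated C G u -> F (c *: u) = c * F u.
  by move=> Du; have := FL c u 0 Du D0; rewrite F0 !addr0.
have DD u v : dominated C G u -> dominated C G v -> dominated C G (u + v).
  by move=> Du Dv; have := dominated_linear CD CZ 1 Gpos Du Dv; rewrite scale1r.
have Fsum n (u : 'I_n -> E) : (forall i, dominated C G (u i)) ->
    dominated C G (\sum_i u i) /\ F (\sum_i u i) = \sum_i F (u i).
  move=> Du; pose Q v a := dominated C G v /\ F v = a.
  apply: (@big_rec2 _ _ Q) => // i v a _ [Dv <-]; split; first exact: DD.
  exact: FD.
have Fle (T : bop K) (k : R) (x y : H) : 0 <= k ->
    (forall z, rnorm (T z) <= k * rnorm z) ->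
    F (linear_form T x y) <= k / 2 * (rinner x x + rinner y y).
  move=> k0 Tk; have Gb := form_graph_bound k x y.
  have Db : dominated C G (bound k x y).
    exists (bound k x y), (k / 2 * (rinner x x + rinner y y)); split => //.
      by rewrite subrr.
    (* The case T = 0 of [C_bound]: the bound is nonnegative, so it dominates itself. *)
    have Cb : C (bound k x y).
      have := @C_bound 0 k x y k0; rewrite (_ : linear_form 0 x y = 0) ?subr0.
        by apply=> z; rewrite rnorm0 mulr_ge0 ?rnorm_ge0.
      by apply/funext => X; rewrite /linear_form rinner0l.
    exact: CD.
  rewrite -(FG _ _ Gb) -subr_ge0.
  have <- : F (- 1 *: linear_form T x y + bound k x y) =
      F (bound k x y) - F (linear_form T x y).
    by rewrite FL // mulN1r addrC.
  apply: Fpos; first exact: dominated_linear.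
  by rewrite scaleN1r addrC; exact: C_bound.
have [Psi PsiE] : exists Psi : bop K -> bop H,
    forall T x y, rinner (Psi T x) y = F (linear_form T x y).
  suff /choice [Psi PsiE] : forall T, exists P : bop H,
      forall x y, rinner (P x) y = F (linear_form T x y) by exists Psi.
  move=> T.
  have [f fE] : exists f : H -> H,
      forall x y, rinner (f x) y = F (linear_form T x y).
    suff /choice [f fE] : forall x, exists z,
        forall y, rinner z y = F (linear_form T x y) by exists f.
    move=> x.
    have lZ (t : R) y : F (linear_form T x (t%:C *: y)) = t * F (linear_form T x y).
      by rewrite linear_formZr FZ.
    apply: (riesz_representation (C := opnorm T / 2 * (rinner x x + 1))) => [y z|//|y].
      by rewrite linear_formDr FD.
    have [y0|y0] := eqVneq (rnorm y) 0.
      have := lZ 0 0; rewrite scaler0 mul0r => F00.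
      by rewrite y0 (rnorm_eq0 y0) F00 mulr0.
    have yp : 0 < rnorm y by rewrite lt_neqAle eq_sym y0 rnorm_ge0.
    (* At the unit vector y / |y| the estimate [Fle] gives exactly the chosen constant. *)
    rewrite -ler_pdivrMr // mulrC -lZ.
    apply: (le_trans (Fle _ _ _ _ (opnorm_ge0 T) (le_opnorm T))).
    rewrite rinnerZl rinnerZr -(rnorm_sqr y).
    by rewrite (_ : (rnorm y)^-1 * _ = 1) //; field.
  (* For complex scalars: in a form, [c] in the first slot equals its conjugate in the second, as in
     the inner product. *)
  have fL : linear f.
    move=> c x y; apply: rinner_inj => z.
    rewrite rinnerDl rinnerZ !fE linear_formDl FD //.
    by rewrite linear_formZ.
  (* The added 1 makes [k] invertible. Testing [Fle] at y = f(x) / k then gives 2 |f x|^2 <= k^2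
     |x|^2 + |f x|^2. *)
  pose k := opnorm T + 1.
  have k0 : 0 < k by rewrite /k ltr_wpDl ?opnorm_ge0.
  have Tk z : rnorm (T z) <= k * rnorm z.
    apply: (le_trans (le_opnorm _ _)).
    by rewrite ler_wpM2r ?rnorm_ge0 // lerDl.
  have fk x : rnorm (f x) <= k * rnorm x.
    rewrite -(@ler_pXn2r _ 2) ?nnegrE ?mulr_ge0 ?rnorm_ge0 ?(ltW k0) //.
    have := Fle T k x (k^-1%:C *: f x) (ltW k0) Tk.
    rewrite -fE !rinnerZr rinnerZl -!rnorm_sqr.
    move/(ler_wpM2l (ltW (mulr_gt0 k0 (ltr0Sn R 1)))).
    have -> : k * 2 * (k^-1 * rnorm (f x) ^+ 2) = 2 * rnorm (f x) ^+ 2.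
      by field; rewrite gt_eqF.
    have -> : k * 2 * (k / 2 * (rnorm x ^+ 2 + k^-1 * (k^-1 * rnorm (f x) ^+ 2))) =
        (k * rnorm x) ^+ 2 + rnorm (f x) ^+ 2.
      by field; rewrite gt_eqF.
    lra.
  by exists (Bop (bounded_bop fL fk)).
have bop_eq (S T : bop H) : (forall x y, rinner (S x) y = rinner (T x) y) -> S = T.
  by move=> ST; apply/val_inj/funext => x; apply: rinner_inj => y; exact: ST.
exists Psi; split.
- move=> c S T; apply: bop_eq => x y.
  rewrite bop_addE bop_scaleE rinnerDl rinnerZ !PsiE linear_form_op FD //.
- by move=> T AT; apply: bop_eq => x y; rewrite PsiE; apply/FG/form_graph1.
- move=> n T _ Tpos x.
  have sumE (y : 'I_n -> H) : \sum_i rinner (mxop (map_mx Psi T) x i) (y i) =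
      F (\sum_i \sum_j linear_form (T i j) (x j) (y i)).
    rewrite (Fsum _ _ _).2 => [|i]; last by apply: (Fsum _ _ _).1.
    apply: eq_bigr => i _; rewrite (Fsum _ _ _).2 //.
    by rewrite rinner_suml; apply: eq_bigr => j _; rewrite mxE PsiE.
  have formE (y : 'I_n -> H) X : (\sum_i \sum_j linear_form (T i j) (x j) (y i)) X =
      \sum_i rinner (mxop T (fun i => X (x i)) i) (X (y i)).
    rewrite fct_sumE; apply: eq_bigr => i _.
    by rewrite fct_sumE rinner_suml.
  (* Nonnegativity in [R[i]] includes a zero imaginary part. That part is [F] at the combination
     with second arguments i x_i, which vanishes at each [X] because [T] is positive at the tuple of
     the X x_i. *)
  rewrite lecE Re_sum Im_sum; apply/andP; split.
    under eq_bigr do rewrite Im_inner.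
    rewrite sumE (_ : \sum_i _ = 0) ?F0 //; apply/funext => X; rewrite formE.
    under eq_bigr do rewrite linearZZ -Im_inner.
    by rewrite -Im_sum ger0_Im.
  rewrite [leRHS](sumE x); apply: Fpos.
    by apply: (Fsum _ _ _).1 => i; apply: (Fsum _ _ _).1.
  move=> X; rewrite formE -Re_sum.
  by have := Tpos (fun i => X (x i)); rewrite lecE => /andP[].
- move=> T k x k0 Tk; rewrite PsiE; apply: (le_trans (Fle _ _ _ _ k0 Tk)).
  by rewrite le_eqVlt; apply/orP; left; apply/eqP; field.
Qed.

End Arveson.

(** * Functionals in the predual *)

Section TraceFunctionals.
Context {R : realType} {H : hilbertType R}.

Lemma cvg_complex (u v : nat -> R) (a b : R) :
  u @ \oo --> a -> v @ \oo --> b ->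
  (fun n => u n +i* v n : (R[i])^o) @ \oo --> (a +i* b : (R[i])^o).
Proof.
move=> ua vb; apply/(@cvgrPdist_lt _ (R[i])^o) => e e0.
have /complex_realP[r er] := gtr0_real e0; move: e0; rewrite er ltcR => r0.
have r2 : 0 < r / 2 by rewrite divr_gt0.
near=> n.
have un : `|a - u n| < r / 2 by near: n; move/cvgrPdist_lt: ua; apply.
have vn : `|b - v n| < r / 2 by near: n; move/cvgrPdist_lt: vb; apply.
rewrite normc_def ltcR /= (le_lt_trans (y := `|a - u n| + `|b - v n|)) //; last first.
  by rewrite [ltRHS]splitr ltrD.
rewrite -(@ler_pXn2r _ 2) ?nnegrE ?sqrtr_ge0 ?addr_ge0 //.
rewrite sqr_sqrtr ?addr_ge0 ?sqr_ge0 //.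
rewrite -(real_normK (num_real (a - u n))) -(real_normK (num_real (b - v n))).
have := mulr_ge0 (normr_ge0 (a - u n)) (normr_ge0 (b - v n)); nra.
Unshelve. all: by end_near. Qed.

Lemma square_summableD (c : R[i]) (x y : nat -> H) :
  square_summable x -> square_summable y ->
  square_summable (fun k => x k + c *: y k).
Proof.
move=> sx sy; pose d := complex.Re `|c|.
apply: (@series_le_cvg _ _
  (fun k => 2 * rnorm (x k) ^+ 2 + (2 * d ^+ 2) * rnorm (y k) ^+ 2)).
- by move=> n; rewrite sqr_ge0.
- have d2 : 0 <= 2 * d ^+ 2 by rewrite mulr_ge0 // sqr_ge0.
  by move=> n; apply: addr_ge0; rewrite mulr_ge0 ?sqr_ge0.
- move=> n.
  have h : rnorm (x n + c *: y n) ^+ 2 <= (rnorm (x n) + d * rnorm (y n)) ^+ 2.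
    have d0 : 0 <= d by rewrite /d normc_def; exact: sqrtr_ge0.
    rewrite ler_pXn2r ?nnegrE ?addr_ge0 ?mulr_ge0 ?rnorm_ge0 //.
    by rewrite -rnormZ ler_rnormD.
  apply: (le_trans h); have := sqr_ge0 (rnorm (x n) - d * rnorm (y n)); nra.
- have cx := is_cvg_seriesZ (f := (fun k => rnorm (x k) ^+ 2) : R^o ^nat)
    (k := 2) sx.
  have cy := is_cvg_seriesZ (f := (fun k => rnorm (y k) ^+ 2) : R^o ^nat)
    (k := 2 * d ^+ 2) sy.
  exact: is_cvg_seriesD cx cy.
Qed.

Lemma square_summableZ (c : R[i]) (x : nat -> H) :
  square_summable x -> square_summable (fun k => c *: x k).
Proof.
move=> sx.
rewrite (_ : (fun k => _) = (fun k => 0 + c *: x k)); last first.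
  by apply/funext => k; rewrite add0r.
apply: square_summableD => //; apply: (@series_le_cvg _ _ (fun k => rnorm (x k) ^+ 2))
  => // n;
  by rewrite ?rnorm0 ?expr0n ?sqr_ge0.
Qed.

(** Absolute convergence, by comparison with |T| / 2 (|x_k|^2 + |y_k|^2). *)
Lemma is_cvg_rinner (T : bop H) (x y : nat -> H) :
  square_summable x -> square_summable y ->
  cvgn (series (fun k => rinner (T (x k)) (y k))).
Proof.
move=> sx sy; apply: (@normed_cvg _ R^o).
have k0 := opnorm_ge0 T.
apply: (@series_le_cvg _ _
  (fun k => opnorm T / 2 * rnorm (x k) ^+ 2 + opnorm T / 2 * rnorm (y k) ^+ 2)).
- by move=> n; exact: normr_ge0.
- have d2 : 0 <= opnorm T / 2 by rewrite divr_ge0.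
  by move=> n; apply: addr_ge0; rewrite mulr_ge0 ?sqr_ge0.
- move=> n.
  have hT := le_opnorm T (x n).
  have h1 := ler_rinner (T (x n)) (y n).
  have h2 := ler_rinner (- T (x n)) (y n).
  rewrite rnormN rinnerNl in h2.
  have h3 : rnorm (T (x n)) * rnorm (y n) <= opnorm T * rnorm (x n) * rnorm (y n).
    by rewrite ler_wpM2r ?rnorm_ge0.
  have h4 := mulr_ge0 k0 (sqr_ge0 (rnorm (x n) - rnorm (y n))).
  rewrite ler_norml; apply/andP; split; nra.
- have cx := is_cvg_seriesZ (f := (fun k => rnorm (x k) ^+ 2) : R^o ^nat)
    (k := opnorm T / 2) sx.
  have cy := is_cvg_seriesZ (f := (fun k => rnorm (y k) ^+ 2) : R^o ^nat)
    (k := opnorm T / 2) sy.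
  exact: is_cvg_seriesD cx cy.
Qed.

Lemma cvg_trace (T : bop H) (x y : nat -> H) :
  square_summable x -> square_summable y ->
  series (fun k => inner (T (x k)) (y k) : (R[i])^o) @ \oo -->
  (limn (series (fun k => rinner (T (x k)) (y k))) +i*
   limn (series (fun k => rinner (T (x k)) ('i *: y k))) : (R[i])^o).
Proof.
move=> sx sy.
have cr := @is_cvg_rinner T _ _ sx sy.
have ci := @is_cvg_rinner T _ _ sx (@square_summableZ 'i _ sy).
rewrite [X in X @ _](_ : _ = fun n => series (fun k => rinner (T (x k)) (y k)) n +i*
  series (fun k => rinner (T (x k)) ('i *: y k)) n : (R[i])^o); first exact: cvg_complex.
apply/funext => n; rewrite /series /=.
elim/big_ind3: _ => // [a b c d e f -> ->|k _]; first by [].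
exact: innerE.
Qed.

Lemma is_cvg_trace (T : bop H) (x y : nat -> H) :
  square_summable x -> square_summable y ->
  cvgn (series (fun k => inner (T (x k)) (y k) : (R[i])^o)).
Proof. by move=> sx sy; apply/cvg_ex; eexists; exact: cvg_trace. Qed.

Lemma Re_trace (p : l2pair H) (T : bop H) :
  complex.Re (trace_functional p T) =
  limn (series (fun k => rinner (T (l2fst p k)) (l2snd p k))).
Proof.
case: p => x y sx sy; rewrite /trace_functional /=.
by rewrite (cvg_lim _ (@cvg_trace T _ _ sx sy)).
Qed.

Lemma trace_linear (p : l2pair H) (c : R[i]) (S T : bop H) :
  trace_functional p (c *: S + T) = c * trace_functional p S + trace_functional p T.
Proof.
case: p => x y sx sy; rewrite /trace_functional /=.
have cS := @is_cvg_trace S _ _ sx sy; have cT := @is_cvg_trace T _ _ sx sy.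
have E := lim_seriesD (is_cvg_seriesZ (k := c) cS) cT.
rewrite (lim_seriesZ c cS) in E.
rewrite -[RHS]E; congr (limn (series _)); apply/funext => k.
transitivity (inner (c *: S (x k) + T (x k)) (y k)); first by [].
by rewrite innerDl innerZl.
Qed.

Lemma trace_continuous (p : l2pair H) :
  continuous (trace_functional p : weakstar H -> (R[i])^o).
Proof.
move=> T; apply: (@continuous_comp (weakstar H)
  (prod_topology (fun _ : l2pair H => (R[i])^o))
  (R[i])^o (fun T q => trace_functional q T) (fun f => f p)).
  exact: initial_continuous.
exact: (@proj_continuous (l2pair H) (fun=> (R[i])^o) p).
Qed.

(** Universal property of the initial topology, then of the product, which is itself a supremum of
    initial topologies. *)
Lemma weakstar_continuous (X : topologicalType) (f : X -> weakstar H) :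
  (forall p, continuous (fun x => trace_functional p (f x) : (R[i])^o)) -> continuous f.
Proof.
move=> cf; apply: continuous_comp_initial => x; apply/cvg_sup => p.
move=> U /=; rewrite (@nbhsE (initial_topology
  (fun g : prod_topology (fun _ : l2pair H => (R[i])^o) => g p))).
case=> B [[V oV <-] Vx] /filterS; apply.
by apply: cf; apply: open_nbhs_nbhs; split.
Qed.

End TraceFunctionals.

(** * Bounds by rotation and polarization *)

Section Normality.
Context {R : realType} {K H : hilbertType R}.

(** Multiplying [T] by the phase |f T| / f T preserves every bound on [T] and turns the value into
    |f T|, so bounding real parts suffices. *)
Lemma functional_bound (f : bop K -> R[i]) :
  (forall (c : R[i]) T, f (c *: T) = c * f T) ->
  (forall (T : bop K) (k : R), 0 <= k -> (forall z, rnorm (T z) <= k * rnorm z) ->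
     complex.Re (f T) <= k) ->
  forall T, `|f T| <= (opnorm T)%:C.
Proof.
move=> fZ fk T; have [->|fT0] := eqVneq (f T) 0.
  by rewrite normr0 ler0c opnorm_ge0.
have nf : `|f T| = (complex.Re `|f T|)%:C by rewrite RRe_real // normr_real.
rewrite nf lecR; have := fk ((`|f T| / f T) *: T) (opnorm T) (opnorm_ge0 T).
rewrite fZ divfK //; apply => z.
rewrite bop_scaleE rnormZ normrM normfV normr_id divff ?normr_eq0 //.
by rewrite mul1r; exact: le_opnorm.
Qed.

Lemma innerDr (x y z : H) : inner x (y + z) = inner x y + inner x z.
Proof. exact: linearDr. Qed.

Lemma inner_sesquilinear (T : bop H) (x y : H) (c d : R[i]) : (c^*)%R = d ->
  inner (T (x + c *: y)) (x + c *: y) =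
  inner (T x) x + d * inner (T x) y + c * inner (T y) x + c * d * inner (T y) y.
Proof.
by move=> <-; rewrite bopD bopZ !innerDl !innerDr !innerZl !innerZr; ring.
Qed.

Lemma inner_polarization (T : bop H) (x y : H) :
  let q c := inner (T (x + c *: y)) (x + c *: y) in
  inner (T x) y = 4^-1 * ((q 1 + -1 * q (-1)) + ('i * q 'i + - 'i * q (- 'i))).
Proof.
move=> q; have qE c d : (c^*)%R = d -> q c = _ := @inner_sesquilinear T x y c d.
have cN1 : ((-1 : R[i])^*)%R = -1 by rewrite rmorphN1.
have cNi : ((- 'i : R[i])^*)%R = 'i.
  by have := congr1 (fun z : R[i] => (z^*)%R) (conjCi R[i]); rewrite conjCK => <-.
rewrite (qE _ _ (conjC1 R[i])) (qE _ _ cN1) (qE _ _ (conjCi R[i])) (qE _ _ cNi).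
have i2 : 'i * 'i = -1 :> R[i] by rewrite -expr2 sqrCi.
(* The imaginary unit is replaced by a variable [j] subject to j^2 = -1, which leaves a polynomial
   identity. *)
suff alg (a b c d j : R[i]) : j * j = -1 -> c = 4^-1 *
    ((a + 1 * c + 1 * d + 1 * 1 * b + -1 * (a + -1 * c + -1 * d + -1 * -1 * b)) +
     (j * (a + - j * c + j * d + j * - j * b) +
      - j * (a + j * c + - j * d + - j * j * b))) by exact: alg i2.
move=> j2.
rewrite [RHS](_ : _ = 4^-1 * (2 * c + 2 * d + j * j * (2 * d - 2 * c))).
  by rewrite j2; field.
ring.
Qed.

(** Termwise polarization, passed to the limit. It reduces normality to diagonal functionals, which
    can be normalized to states. *)
Lemma trace_polarization (x y : nat -> H) (sx : square_summable x)
    (sy : square_summable y) (T : bop H) :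
  let q c := trace_functional (L2pair (square_summableD (c := c) sx sy)
    (square_summableD (c := c) sx sy)) T in
  trace_functional (L2pair sx sy) T =
  4^-1 * ((q 1 + -1 * q (-1)) + ('i * q 'i + - 'i * q (- 'i))).
Proof.
move=> q; rewrite /trace_functional /=.
pose t c k : (R[i])^o := inner (T (x k + c *: y k)) (x k + c *: y k).
have h c : series (t c) @ \oo --> (q c : (R[i])^o).
  by have s := @square_summableD R H c x y sx sy; exact: (@is_cvg_trace R H T _ _ s s).
have E := cvgZl_tmp (k := 4^-1) (cvgD (cvgD (h 1) (cvgZl_tmp (k := -1) (h (-1))))
  (cvgD (cvgZl_tmp (k := 'i) (h 'i)) (cvgZl_tmp (k := - 'i) (h (- 'i))))).
have tE : series (fun k => inner (T (x k)) (y k) : (R[i])^o) = fun n => 4^-1 *: (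
    (series (t 1) n + -1 *: series (t (-1)) n) +
    ('i *: series (t 'i) n + - 'i *: series (t (- 'i)) n)) : (R[i])^o.
  apply/funext => n; rewrite /series /= !scaler_sumr -!big_split /= scaler_sumr.
  apply: eq_bigr => k _; exact: inner_polarization.
have F := eventually_filter.
rewrite tE (cvg_lim _ (E F F F F F F F)) //.
Qed.

End Normality.

(** * Normality of the extension *)

Section NormalExtension.
Context {R : realType} {K H : hilbertType R}.

Lemma summable_eq0 (x : nat -> H) : square_summable x ->
  limn (series (fun k => rnorm (x k) ^+ 2 : R)) = 0 -> forall k, x k = 0.
Proof.
move=> sx s0 k.
have nd : nondecreasing_seq (series (fun k => rnorm (x k) ^+ 2 : R)).
  apply/nondecreasing_seqP => n; rewrite /series /= big_nat_recr //=.
  by rewrite lerDl sqr_ge0.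
(* A partial sum at [n] has the terms below [n], so index k + 1 is the first one that contains
   x_k. *)
have := nondecreasing_cvgn_le nd sx k.+1; rewrite s0 /series /= big_nat_recr //=.
move=> h; apply: rnorm_eq0; apply/eqP; rewrite -sqrf_eq0 eq_le sqr_ge0 andbT.
by apply: le_trans h; rewrite lerDr sumr_ge0 // => i _; rewrite sqr_ge0.
Qed.

Lemma trace_diag0 (x : nat -> H) (sx : square_summable x) (T : bop H) :
  (forall k, x k = 0) -> trace_functional (L2pair sx sx) T = 0.
Proof.
move=> x0; rewrite /trace_functional /=.
rewrite (_ : series _ = fun=> 0); first exact: lim_cst.
apply/funext => n; rewrite /series /= big1 // => k _.
by rewrite x0 bop0 linear0l.
Qed.

Lemma trace_diagZ (t : R) (x : nat -> H) (sx : square_summable x)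
    (sy : square_summable (fun k => t%:C *: x k)) (T : bop H) :
  trace_functional (L2pair sy sy) T = (t ^+ 2)%:C * trace_functional (L2pair sx sx) T.
Proof.
have E := lim_seriesZ (t ^+ 2)%:C (@is_cvg_trace R H T x x sx sx).
rewrite /trace_functional /= -[RHS]E; congr (limn (series _)); apply/funext => k.
rewrite bopZ innerZl innerZr mulrA.
by rewrite [X in _ * X * _]conjc_real -rmorphM -expr2.
Qed.

Lemma trace_diag1 (x : nat -> H) (sx : square_summable x) :
  limn (series (fun k => rnorm (x k) ^+ 2 : R)) = 1 ->
  trace_functional (L2pair sx sx) bop1 = 1.
Proof.
move=> s1; rewrite /trace_functional /=.
have h : series (fun k => rnorm (x k) ^+ 2 : R) @ \oo --> (1 : R).
  by rewrite -s1; exact: sx.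
have z : (fun _ : nat => 0 : R) @ \oo --> (0 : R) by exact: cvg_cst.
have E := cvg_complex h z.
rewrite (_ : series _ = (fun n => series (fun k => rnorm (x k) ^+ 2) n +i* 0 : (R[i])^o)).
  by rewrite (cvg_lim _ E).
apply/funext => n; rewrite /series /=.
elim/big_ind2: _ => // [a b c d -> ->|k _].
  by apply/eqP; rewrite eq_complex /= addr0 !eqxx.
by rewrite inner_norm rnormE -rmorphXn.
Qed.

Variables (M A : set (bop K)) (Phi Psi : bop K -> bop H).
Hypothesis A1 : A bop1.
Hypothesis Phi_linear : linear_on A Phi.
Hypothesis Phi1 : Phi bop1 = bop1.
Hypothesis Phi_normal : normal_map A Phi.
Hypothesis normal_extensions :
  forall phi : bop K -> (R[i]%C)^o, state A phi -> normal_functional A phi ->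
    forall psi : bop K -> (R[i]%C)^o, state M psi ->
      (forall T, A T -> psi T = phi T) -> normal_functional M psi.
Hypothesis Psi_linear : forall (c : R[i]) S T, Psi (c *: S + T) = c *: Psi S + Psi T.
Hypothesis Psi_ext : forall T, A T -> Psi T = Phi T.
Hypothesis Psi_bound : forall (T : bop K) (k : R) (x : H), 0 <= k ->
  (forall z, rnorm (T z) <= k * rnorm z) -> rinner (Psi T x) x <= k * rinner x x.

Lemma normal_diag1 (x : nat -> H) (sx : square_summable x) :
  limn (series (fun k => rnorm (x k) ^+ 2 : R)) = 1 ->
  normal_functional M (fun T => trace_functional (L2pair sx sx) (Psi T)).
Proof.
move=> s1; set psi : bop K -> (R[i])^o := fun T => _.
have psiL c S T : psi (c *: S + T) = c * psi S + psi T.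
  by rewrite /psi Psi_linear trace_linear.
have psi0 : psi 0 = 0.
  have := psiL 1 0 0; rewrite scale1r addr0 mul1r.
  by rewrite -[X in X = _]addr0 => /addrI.
have psiZ c T : psi (c *: T) = c * psi T.
  by have := psiL c T 0; rewrite psi0 !addr0.
have psi1 : psi bop1 = 1 by rewrite /psi Psi_ext // Phi1 trace_diag1.
(* After rotation only real parts matter; [Psi_bound] at each x_i, summed with sum_i |x_i|^2 = 1,
   gives the bound [k]. *)
have psib : forall T, `|psi T| <= (opnorm T)%:C.
  apply: functional_bound => // T k k0 Tk; rewrite /psi Re_trace /=.
  have E := lim_seriesZ (f := (fun i => rnorm (x i) ^+ 2) : R^o ^nat) k sx.
  rewrite s1 in E; rewrite -[leRHS]mulr1 -[leRHS]E.
  apply: lim_series_le.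
  - exact: is_cvg_rinner.
  - exact: (is_cvg_seriesZ (f := (fun i => rnorm (x i) ^+ 2) : R^o ^nat) (k := k) sx).
  - by move=> n; rewrite (le_trans (Psi_bound _ k0 Tk)) // -rnorm_sqr.
pose phi : bop K -> (R[i])^o := fun T => trace_functional (L2pair sx sx) (Phi T).
have psiphi T : A T -> psi T = phi T by move=> AT; rewrite /psi Psi_ext.
apply: (normal_extensions (phi := phi)).
- split; [| |by rewrite -psiphi].
  + by move=> c S T AS AT; rewrite /phi Phi_linear // trace_linear.
  + by move=> T AT; rewrite -psiphi.
- move=> T; apply: (@continuous_comp (subspace (A : set (weakstar K))) (weakstar H)
    (R[i])^o Phi (trace_functional (L2pair sx sx))); first exact: Phi_normal.
  exact: trace_continuous.
- by split => // c S T _ _; exact: psiL.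
- exact: psiphi.
Qed.

Lemma normal_diag (x : nat -> H) (sx : square_summable x) :
  normal_functional M (fun T => trace_functional (L2pair sx sx) (Psi T)).
Proof.
pose s := limn (series (fun k => rnorm (x k) ^+ 2 : R)).
have [s0|s0] := eqVneq s 0.
  rewrite (_ : (fun _ => _) = fun=> 0); first by move=> T; exact: cst_continuous.
  by apply/funext => T; rewrite trace_diag0 //; exact: summable_eq0.
have sp : 0 < s.
  rewrite lt_neqAle eq_sym s0 /=; apply: limr_ge; first exact: sx.
  by near=> n; apply: sumr_ge0 => k _; rewrite sqr_ge0.
(* Scaling by s^(-1/2) makes the squared norms sum to 1; the functional is then [s] times a normal
   one. *)
pose t := (Num.sqrt s)^-1.
have t2 : t ^+ 2 = s^-1 by rewrite /t exprVn sqr_sqrtr // ltW.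
have sy := @square_summableZ R H t%:C _ sx.
have s1 : limn (series (fun k => rnorm (t%:C *: x k) ^+ 2 : R)) = 1.
  have E := lim_seriesZ (f := (fun i => rnorm (x i) ^+ 2) : R^o ^nat) (t ^+ 2) sx.
  rewrite [RHS](_ : _ = t ^+ 2 * s); last by rewrite t2 mulVf.
  rewrite -[RHS]E; congr (limn (series _)); apply/funext => k.
  by rewrite rnorm_sqr rinnerZl rinnerZr -rnorm_sqr mulrA -expr2.
have := @normal_diag1 _ sy s1.
rewrite (_ : (fun T => trace_functional (L2pair sx sx) (Psi T)) =
  fun T => s%:C *: (trace_functional (L2pair sy sy) (Psi T) : (R[i])^o)).
  by move=> h T; apply: cvgZl_tmp; exact: h.
apply/funext => T; rewrite trace_diagZ t2.
rewrite -[RHS]/(s%:C * (s^-1%:C * _)) mulrA -rmorphM divff // mul1r //.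
Unshelve. all: by end_near. Qed.

Lemma normal_extension : normal_map M Psi.
Proof.
apply: (@weakstar_continuous R H (subspace (M : set (weakstar K)))) => -[x y sx sy].
pose q c : l2pair H := L2pair (square_summableD (c := c) sx sy)
  (square_summableD (c := c) sx sy).
rewrite (_ : (fun _ => _) = fun T => 4^-1 *: ((trace_functional (q 1) (Psi T) +
    -1 *: trace_functional (q (-1)) (Psi T)) +
    ('i *: trace_functional (q 'i) (Psi T) +
     - 'i *: trace_functional (q (- 'i)) (Psi T))) : (R[i])^o); last first.
  by apply/funext => T; exact: trace_polarization.
have h c := @normal_diag _ (square_summableD (c := c) sx sy).
move=> T; apply: cvgZl_tmp; apply: cvgD; apply: cvgD; do ?apply: cvgZl_tmp; exact: h.
Qed.

End NormalExtension.

Theorem proposition3p4 (R : realType) (K H : hilbertType R)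
    (M A : set (bop K)) (D : set (bop H)) (Phi : bop K -> bop H) :
  von_neumann_algebra M ->
  A `<=` M -> unital_subalgebra A -> weakstar_closed A ->
  von_neumann_algebra D ->
  (forall T, A T -> D (Phi T)) ->
  linear_on A Phi ->
  Phi bop1 = bop1 ->
  normal_map A Phi ->
  completely_contractive A Phi ->
  (forall phi : bop K -> (R[i]%C)^o, state A phi -> normal_functional A phi ->
    forall psi : bop K -> (R[i]%C)^o, state M psi ->
      (forall T, A T -> psi T = phi T) -> normal_functional M psi) ->
  exists Psi : bop K -> bop H,
    [/\ linear_on M Psi,
        completely_positive M Psi,
        normal_map M Psi &
        forall T, A T -> Psi T = Phi T].
Proof.
move=> _ _ Aalg _ _ _ Phi_linear Phi1 Phi_normal Phi_cc normal_ext.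
have [Psi [PsiL PsiA Psi_cp Psi_bound]] :=
  completely_positive_extension Aalg Phi_linear Phi1 Phi_cc.
exists Psi; split.
- by move=> c S T _ _; exact: PsiL.
- by move=> n T _; exact: Psi_cp.
- exact: (normal_extension (subalgebra1 Aalg) Phi_linear Phi1 Phi_normal normal_ext).
- exact: PsiA.
Qed.
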